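(* Let $d\geq 1$, $r\geq d+1$, $1\leq m\leq r$ and $m\leq k\leq \min\{m+d,r\}$ be integers. Let $V$ be a finite set with $|V|\geq \max\{m+d,r\}$. Let $X$ be a $d$-collapsible simplicial complex on vertex set $V$, and let $M$ be a matroid of rank $r$ on $V$ with rank function $\rho$. Assume that for every set $U=\{u_1,\ldots,u_d,v_1,\ldots,v_m\}\subset V$ (of $d+m$ distinct elements) with $\rho(U)\geq k$, there is some $i\in\{1,\ldots,m\}$ such that $\{u_1,\ldots,u_d,v_i\}\in X$. Then there is some $\tau\in X$ such that $\rho(\tau)\geq r+1-m$ and $\rho(V\setminus \tau)\leq k-1$.
   Context: A simplicial complex $X$ on vertex set $V$ is a family of subsets of the finite set $V$ closed under taking subsets; its elements are simplices (faces). A simplex $\sigma\in X$ is a free face if it is contained in a unique maximal face of $X$. If $\sigma$ is a free face with $|\sigma|\leq d$, an elementary $d$-collapse removes from $X$ all simplices containing $\sigma$. $X$ is $d$-collapsible if some sequence of elementary $d$-collapses reduces $X$ to the void complex $\emptyset$. For a matroid $M$ on $V$, the rank function $\rho$ assigns to $W\subset V$ the maximum size of an independent subset of $W$; the rank of $M$ is $\rho(V)$. *)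

(* Defs.v *)
From mathcomp Require Import all_boot.

Set Implicit Arguments.
Unset Strict Implicit.
Unset Printing Implicit Defensive.

(* The whole finite type V plays the role of the ground set. A complex is given
   by its set of faces: the void complex set0 is allowed (and is distinct from
   [set set0]), and elements of V need not be faces. *)
Definition simplicial_complex (V : finType) (X : {set {set V}}) : Prop :=
  forall s t : {set V}, t \in X -> s \subset t -> s \in X.

Definition maximal_faces (V : finType) (X : {set {set V}}) : {set {set V}} :=
  [set t | maxset (fun s => s \in X) t].

Definition free_face (V : finType) (X : {set {set V}}) (s : {set V}) : bool :=
  (s \in X) && (#|[set t in maximal_faces X | s \subset t]| == 1).

Definition elementary_collapse (V : finType) (d : nat) : rel {set {set V}} :=
  fun X Y => [exists s : {set V},
    [&& free_face X s, #|s| <= d & Y == [set t in X | ~~ (s \subset t)]]].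

Definition collapsible (V : finType) (d : nat) (X : {set {set V}}) : bool :=
  connect (@elementary_collapse V d) X set0.

Record matroid (V : finType) := Matroid {
  indep : {set {set V}};
  indep0 : set0 \in indep;
  indepS : forall I J : {set V}, J \in indep -> I \subset J -> I \in indep;
  indep_exchange : forall I J : {set V}, I \in indep -> J \in indep ->
    #|I| < #|J| -> exists2 x, x \in J :\: I & x |: I \in indep
}.

Definition rank (V : finType) (M : matroid V) (W : {set V}) : nat :=
  \max_(I in indep M | I \subset W) #|I|.

(* Main.v *)
Require Import Defs.
From mathcomp Require Import all_boot.
From mathcomp Require Import zify.

(** Call a d-set S good if its rank is at least k - m, and stop the collapse of
    X at the first step that removes a good face S; let sigma be the free face
    of that step and tau the maximal face above it.  If v |: S is a face but v
    is not in tau, then v |: S was removed earlier, through some sigma' with at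
    most d elements; dropping from v |: S an element w of S outside sigma' leaves
    a d-set which is not good, so rank S = k - m and v lies in the span of S.
    Hence the complement of tau consists of points of A = {v | v |: S \notin X}
    and, only when rank S = k - m, of points in the span of S.  The hypothesis
    on (d+m)-sets says that #|A| < m or rank (S :|: A) < k, and submodularity
    of the rank turns this into both bounds. *)

Set Implicit Arguments.
Unset Strict Implicit.
Unset Printing Implicit Defensive.

(** * Rank function of a matroid *)

Section Rank.
Variables (V : finType) (M : matroid V).
Implicit Types A B C I J S W : {set V}.
Local Notation rk := (rank M).

Lemma card_indep_le_rank I W : I \in indep M -> I \subset W -> #|I| <= rk W.
Proof.
by move=> Iin IW; rewrite /rank (bigD1 I) /= ?Iin ?IW // leq_maxl.
Qed.

Lemma rank_le n W :
  (forall I, I \in indep M -> I \subset W -> #|I| <= n) -> rk W <= n.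
Proof. by move=> le_n; apply/bigmax_leqP => I /andP[]; apply: le_n. Qed.

Lemma rank_attained W :
  exists I, [/\ I \in indep M, I \subset W & #|I| = rk W].
Proof.
have [|I /andP[Iin IW] rkE] :=
    @eq_bigmax_cond _ [pred I | (I \in indep M) && (I \subset W)] (fun I => #|I|).
  by apply/card_gt0P; exists set0; rewrite inE indep0 sub0set.
by exists I; split=> //; rewrite -rkE; apply: eq_bigl.
Qed.

Lemma rank_subset A B : A \subset B -> rk A <= rk B.
Proof.
move=> AB; apply: rank_le => I Iin IA.
exact: card_indep_le_rank Iin (subset_trans IA AB).
Qed.

Lemma rank_le_card A : rk A <= #|A|.
Proof. by apply: rank_le => I _; apply: subset_leq_card. Qed.

Lemma rank_indep I : I \in indep M -> rk I = #|I|.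
Proof.
by move=> Iin; apply/eqP; rewrite eqn_leq rank_le_card card_indep_le_rank.
Qed.

Lemma indep_extend I W : I \in indep M -> I \subset W ->
  exists J, [/\ J \in indep M, I \subset J, J \subset W & #|J| = rk W].
Proof.
move En: (rk W - #|I|) => n; elim: n I En => [|n IHn] I En Iin IW.
  exists I; split=> //; apply/eqP.
  by rewrite eqn_leq card_indep_le_rank //= -subn_eq0 En.
have [K [Kin KW cK]] := rank_attained W.
have [|x] := indep_exchange Iin Kin; first by rewrite cK -subn_gt0 En.
rewrite inE => /andP[xI xK] xIin.
have [||J [Jin xIJ JW cJ]] := IHn (x |: I) _ xIin.
- by rewrite cardsU1 xI; lia.
- by rewrite subUset sub1set IW (subsetP KW).
by exists J; split=> //; apply: subset_trans xIJ; apply: subsetUr.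
Qed.

(** Extend a basis [I] of [A :&: B] to a basis [J] of [B], then to a basis [K] of [A :|: B]. Since
    [J] is maximal in [B], [K :\: J] lies in [A], so [I :|: (K :\: J)] is an independent subset of
    [A]. *)
Lemma rank_submod A B : rk (A :|: B) + rk (A :&: B) <= rk A + rk B.
Proof.
have [I [Iin]] := rank_attained (A :&: B).
rewrite subsetI => /andP[IA IB] <-.
have [J [Jin IJ JB cJ]] := indep_extend Iin IB.
have [K [Kin JK KAB <-]] := indep_extend Jin (subset_trans JB (subsetUr A B)).
have KJA : K :\: J \subset A.
  apply/subsetP => x /setDP[xK xJ].
  have /setUP[//|xB] := subsetP KAB x xK.
  have xJin : x |: J \in indep M.
    by apply: indepS Kin _; rewrite subUset sub1set xK.
  have xJB : x |: J \subset B by rewrite subUset sub1set xB.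
  by have := card_indep_le_rank xJin xJB; rewrite cardsU1 xJ -cJ ltnn.
have IKin : I :|: (K :\: J) \in indep M.
  by apply: indepS Kin _; rewrite subUset subsetDl (subset_trans IJ JK).
have IKA : I :|: (K :\: J) \subset A by rewrite subUset IA.
have := card_indep_le_rank IKin IKA.
have -> : #|I :|: (K :\: J)| = #|I| + #|K :\: J|.
  apply/eqP; rewrite (leq_card_setU _ _).2 disjoints_subset setCD.
  exact: subset_trans IJ (subsetUr _ _).
by have := cardsID J K; rewrite (setIidPr JK) -cJ; lia.
Qed.

Lemma rank_setU_le A B : rk (A :|: B) <= rk A + rk B.
Proof. exact: leq_trans (leq_addr _ _) (rank_submod A B). Qed.

Lemma rank_setU_span C B :
  (forall x, x \in B -> rk (x |: C) <= rk C) -> rk (C :|: B) <= rk C.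
Proof.
move=> spanB; have [I [Iin IC cI]] := rank_attained C.
have [J [Jin JCB <-]] := rank_attained (C :|: B).
rewrite leqNgt -cI; apply/negP => /(indep_exchange Iin Jin)[x].
rewrite inE => /andP[xI xJ] xIin.
have rkx : rk C < rk (x |: C).
  have := card_indep_le_rank xIin (setUS [set x] IC).
  by rewrite cardsU1 xI cI.
have /setUP[xC|xB] := subsetP JCB x xJ.
  by move: rkx; rewrite (setUidPr _) ?sub1set ?ltnn.
by have := spanB x xB; rewrite leqNgt rkx.
Qed.

(** Greedy choice: add elements of [A] that raise the rank while there are any, then arbitrary ones
    until the size is exactly [m]. *)
Lemma rank_setU_card_subset m S A : m <= #|A| ->
  exists W, [/\ W \subset A, #|W| = m & minn (rk S + m) (rk (S :|: A)) <= rk (S :|: W)].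
Proof.
elim: m => [|m IHm] mA.
  by exists set0; rewrite sub0set cards0 addn0 setU0 geq_minl.
have [W [WA cW rkW]] := IHm (ltnW mA).
have [le_rk|lt_rk] := leqP (rk (S :|: A)) (rk (S :|: W)).
  have /set0Pn[a] : A :\: W != set0.
    by rewrite -card_gt0 cardsD (setIidPr WA) cW subn_gt0.
  case/setDP => aA aW; exists (a |: W); rewrite subUset sub1set aA WA cardsU1 aW cW.
  split=> //; rewrite geq_min (leq_trans le_rk) ?orbT // rank_subset //.
  exact: setUS (subsetUr _ _).
have [a aA rka] : exists2 a, a \in A & rk (S :|: W) < rk (a |: (S :|: W)).
  apply/exists_inP; apply: contraLR lt_rk; rewrite negb_exists_in -leqNgt.
  move=> /forall_inP span; apply: leq_trans (rank_setU_span (B := A) _).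
    by apply: rank_subset; rewrite setUAC; apply: subsetUl.
  by move=> x /span; rewrite -leqNgt.
have aW : a \notin W.
  apply: contraL rka => aW; rewrite -leqNgt (setUidPr _) // sub1set inE aW.
  exact: orbT.
exists (a |: W); rewrite subUset sub1set aA WA cardsU1 aW cW; split=> //.
by rewrite setUCA; lia.
Qed.

End Rank.

(** * Collapse sequences and the first removal of a distinguished face *)

Section Collapse.
Variables (V : finType) (d : nat) (G : pred {set V}).
Implicit Types (X Y : {set {set V}}) (S s t tau : {set V}).

Lemma maximal_face_exists Y S :
  S \in Y -> exists2 t, t \in maximal_faces Y & S \subset t.
Proof.
by move=> /(maxset_exists (P := fun s => s \in Y))[t tmax St]; exists t; rewrite ?inE.
Qed.

Lemma collapsible_first_removal X S0 :
    simplicial_complex X -> collapsible d X -> S0 \in X -> G S0 ->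
  exists S tau, [/\ S \in X, G S, tau \in X, S \subset tau &
    forall t, t \in X -> S \subset t -> t \subset tau \/
      exists s, [/\ s \subset t, #|s| <= d &
        forall S', S' \in X -> G S' -> ~~ (s \subset S')]].
Proof.
move=> cxX /connectP[p pathp lastp] S0X GS0.
pose removed t := exists s, [/\ s \subset t, #|s| <= d &
  forall S', S' \in X -> G S' -> ~~ (s \subset S')].
(* Invariant for the current complex [Y]: no face in [G] is lost yet, and each lost face contains a
   small set that lies below no face in [G]. The sequence cannot end in this state, because [S0]
   would belong to [set0]. *)
suff walk q Y : path (@elementary_collapse V d) Y q -> set0 = last Y q ->
    Y \subset X -> (forall S, S \in X -> G S -> S \in Y) ->
    (forall t, t \in X -> t \in Y \/ removed t) ->
  exists S tau, [/\ S \in X, G S, tau \in X, S \subset tau &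
    forall t, t \in X -> S \subset t -> t \subset tau \/ removed t].
  by apply: (walk p X) => // t; left.
elim: q Y => [|Z q IHq] Y /=.
  by move=> _ <- _ /(_ _ S0X GS0); rewrite inE.
case/andP=> /existsP[s /and3P[/andP[_ /cards1P[tau tauE]] sd /eqP ZE]] pathq lastq.
move=> YX GY remY.
have maxE t : (t \in maximal_faces Y) && (s \subset t) = (t == tau).
  by have /setP/(_ t) := tauE; rewrite !inE.
have tauX : tau \in X.
  have := maxE tau; rewrite eqxx inE => /andP[/maxsetp tauY _].
  exact: (subsetP YX).
have sub_tau t : t \in Y -> s \subset t -> t \subset tau.
  move=> /maximal_face_exists[t' t'max tt'] st.
  by have := maxE t'; rewrite t'max (subset_trans st tt') => /esym/eqP <-.
have [/exists_inP[S SX /andP[GS sS]]|noS] :=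
    boolP [exists S in X, G S && (s \subset S)].
  exists S, tau; split=> //; first exact: sub_tau (GY S SX GS) sS.
  move=> t tX St; have [tY|] := remY t tX; last by right.
  by left; apply: sub_tau tY (subset_trans sS St).
have nsS S : S \in X -> G S -> ~~ (s \subset S).
  move=> SX GS; apply: contra noS => sS.
  by apply/exists_inP; exists S; rewrite ?GS.
apply: IHq pathq lastq _ _ _ => [|S SX GS|t tX]; rewrite {}ZE.
- by apply: subset_trans YX; apply/subsetP => t; rewrite inE => /andP[].
- by rewrite inE GY ?nsS.
have [tY|] := remY t tX; last by right.
by have [st|nst] := boolP (s \subset t); [right; exists s | left; rewrite inE tY].
Qed.

End Collapse.

(** * Rank bounds for the face [tau] *)

Lemma tuple_of_set (V : finType) n (S : {set V}) : #|S| = n ->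
  exists u : n.-tuple V, uniq u /\ u =i S.
Proof.
move=> cS; have szS : size (enum S) == n by rewrite -cardE cS.
by exists (Tuple szS); split=> [|x]; rewrite ?enum_uniq ?mem_enum.
Qed.

Theorem theorem1p6 (d r m k : nat)
    (hd : 1 <= d) (hr : d + 1 <= r) (hm : 1 <= m <= r)
    (hk : m <= k <= minn (m + d) r)
    (V : finType) (hV : maxn (m + d) r <= #|V|)
    (X : {set {set V}}) (hX : simplicial_complex X) (hcX : collapsible d X)
    (M : matroid V) (hM : rank M [set: V] = r)
    (hXM : forall (u : d.-tuple V) (v : m.-tuple V), uniq (u ++ v) ->
       k <= rank M [set x in u ++ v] ->
       exists i : 'I_m, [set x in u] :|: [set tnth v i] \in X) :
  exists2 tau : {set V}, tau \in X &
    r + 1 - m <= rank M tau /\ rank M (~: tau) <= k - 1.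
Proof.
have face_setU1 (S W : {set V}) : #|S| = d -> #|W| = m -> W \subset ~: S ->
    k <= rank M (S :|: W) -> exists2 v, v \in W & v |: S \in X.
  move=> /tuple_of_set[u [uniq_u uS]] /tuple_of_set[v [uniq_v vW]] WS rkSW.
  have [||i] := hXM u v.
  - rewrite cat_uniq uniq_u uniq_v andbT; apply/hasPn => x.
    by rewrite vW => /(subsetP WS); rewrite inE /= uS.
  - rewrite (_ : [set x in u ++ v] = S :|: W) //.
    by apply/setP => x; rewrite !inE mem_cat uS vW.
  rewrite (_ : [set x in u] = S); last by apply/setP => x; rewrite inE uS.
  by rewrite setUC; exists (tnth v i) => //; rewrite -vW mem_tnth.
pose good (S : {set V}) := (#|S| == d) && (k - m <= rank M S).
(* As [d < r], some [d]-set has rank at least [d >= k - m]; [m] further points chosen greedily bring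
   the rank to at least [k], and the hypothesis makes the [d]-set a face. *)
have [S0 S0X goodS0] : exists2 S, S \in X & good S.
  have [|S [_ cS]] := @rank_setU_card_subset _ M d set0 setT.
    by rewrite cardsT; lia.
  rewrite !set0U hM => rkS.
  have [|W [WS cW rkW]] := @rank_setU_card_subset _ M m S (~: S).
    by have := cardsC S; lia.
  rewrite setUCr hM in rkW.
  have [|v _ vSX] := face_setU1 S W cS cW WS; first by lia.
  by exists S; [apply: hX vSX _; apply: subsetUr | rewrite /good cS eqxx; lia].
have [S [tau [SX /andP[/eqP cS rkS] tauX Stau later]]] :=
  collapsible_first_removal hX hcX S0X goodS0.
pose A := [set v | (v \notin S) && (v |: S \notin X)].
(* Otherwise a greedy [W] in [A] has [rank M (S :|: W) >= k], because [rank M S + m >= k]; a face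
   [v |: S] with [v] in [W] contradicts the choice of [A]. *)
have SAsmall : #|A| < m \/ rank M (S :|: A) < k.
  have [mA|] := leqP m #|A|; [right | by left].
  rewrite ltnNge; apply/negP => rkSA.
  have [W [WA cW rkW]] := rank_setU_card_subset M S mA.
  have [||v vW vSX] := face_setU1 S W cS cW; [|by lia|].
    by apply: subset_trans WA _; apply/subsetP => v; rewrite !inE => /andP[].
  by have := subsetP WA v vW; rewrite inE vSX andbF.
have CtauA v : v \notin tau ->
    v \in A \/ rank M S = k - m /\ rank M (v |: S) <= rank M S.
  move=> vtau; have vS : v \notin S by apply: contra vtau => /(subsetP Stau).
  have [vSX|vSX] := boolP (v |: S \in X); last by left; rewrite inE vS.
  right; have [/subsetP/(_ v)|[s [svS sd sG]]] := later _ vSX (subsetUr _ _).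
    by rewrite setU11 (negPf vtau) => /(_ isT).
  (* If [S] were inside [s], then [#|s| <= d] would force [s = S], which is good. *)
  have /subsetPn[w wS ws] : ~~ (S \subset s).
    apply/negP => Ss; have /eqP Es : S == s by rewrite eqEcard Ss cS.
    by have := sG S SX; rewrite /good cS eqxx rkS -Es subxx => /(_ isT).
  have wvS : w \in v |: S by rewrite inE wS orbT.
  (* Putting [w] back raises the rank by at most one, from below [k - m]. *)
  have rk_drop := rank_setU_le M [set w] ((v |: S) :\ w).
  rewrite setD1K // in rk_drop.
  have := rank_le_card M [set w]; rewrite cards1 => rkw.
  have rkvS := rank_subset M (subsetUr [set v] S).
  suff : ~~ good ((v |: S) :\ w).
    rewrite /good (_ : #|_| = d) ?eqxx //=; first by lia.
    by have := cardsD1 w (v |: S); rewrite wvS cardsU1 vS cS; lia.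
  apply: contraL isT => goodS'; have := sG _ _ goodS'.
  rewrite subsetD1 svS ws; apply; apply: hX vSX _; exact: subD1set.
have boundC : #|~: tau| < m \/ rank M (S :|: ~: tau) < k.
  have [rkSk|rkSk] := eqVneq (rank M S) (k - m); last first.
    have CA : ~: tau \subset A.
      apply/subsetP => v; rewrite inE => /CtauA[//|[/eqP]].
      by rewrite (negPf rkSk).
    case: SAsmall => [cA|rkSA]; [left | right].
      exact: leq_ltn_trans (subset_leq_card CA) cA.
    by apply: leq_ltn_trans rkSA; rewrite rank_subset ?setUS.
  (* Here [rank M S = k - m], so [#|A| < m] also gives [rank M (S :|: A) < k], and every point off
     [tau] is spanned by [S :|: A]. *)
  right; apply: (@leq_ltn_trans (rank M (S :|: A))); last first.
    case: SAsmall => // cA; have := rank_setU_le M S A.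
    by have := rank_le_card M A; lia.
  apply: leq_trans (rank_subset _ _) (rank_setU_span (B := ~: tau) _).
    by rewrite setUAC; apply: subsetUl.
  move=> v; rewrite inE => /CtauA[vA|[_ rkvS]].
    by rewrite (setUidPr _) // sub1set inE vA orbT.
  have := rank_submod M (v |: S) (S :|: A); rewrite -setUA (setUA S S) setUid.
  have : rank M S <= rank M ((v |: S) :&: (S :|: A)).
    by rewrite rank_subset // subsetI subsetUl subsetUr.
  by lia.
(* If the complement has fewer than [m] points, subadditivity suffices, as [m <= k]. Otherwise
   submodularity for [tau] and [S :|: ~: tau] gives [r + (k - m) <= rank M tau + (k - 1)]. *)
exists tau => //; case: boundC => [cC|rkSC].
  have := rank_setU_le M tau (~: tau); have := rank_le_card M (~: tau).
  by rewrite setUCr hM; lia.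
have rkC : rank M (~: tau) <= rank M (S :|: ~: tau) by rewrite rank_subset ?subsetUr.
have := rank_submod M tau (S :|: ~: tau).
rewrite setUCA setUCr setUT hM.
have : rank M S <= rank M (tau :&: (S :|: ~: tau)).
  by rewrite rank_subset // subsetI Stau subsetUl.
by lia.
Qed.
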